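(* Let $\mathfrak{g}$ be a Borel subalgebra of the complex simple Lie algebra of type $A_2$, i.e. $\mathfrak{sl}(3,\mathbb{C})$, with simple roots $\alpha_1,\alpha_2$ and positive roots $\alpha_1,\alpha_2,\alpha_1+\alpha_2$. Let $\mathfrak{g}'=\langle X_{\alpha_1},X_{\alpha_2},X_{\alpha_1+\alpha_2}\rangle$ be its derived algebra. Then the following hold, where conjugacy is under the group generated by the automorphisms $e^{\mathrm{ad}(x)}$, $x\in\mathfrak{g}'$. (1) Representatives of the conjugacy classes of one-dimensional subalgebras of $\mathfrak{g}'$ are $$\langle X_{\alpha_2}\rangle,\qquad \langle X_{\alpha_1+\alpha_2}\rangle,\qquad \langle X_{\alpha_1}+cX_{\alpha_2}\rangle\quad(c\in\mathbb{C}).$$ (2) Representatives of the conjugacy classes of two-dimensional subalgebras of $\mathfrak{g}'$ are $$\langle X_{\alpha_2},X_{\alpha_1+\alpha_2}\rangle,\qquad \langle X_{\alpha_1+\alpha_2},X_{\alpha_1}+\gamma X_{\alpha_2}\rangle\quad(\gamma\in\mathbb{C}).$$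
   Context: For each positive root $\alpha$, $X_\alpha$ denotes a fixed nonzero root vector for $\alpha$. Angle brackets denote complex linear span. Two subalgebras of $\mathfrak{g}'$ are conjugate if one is carried onto the other by an element of the group generated by all $e^{\mathrm{ad}(x)}$ with $x\in\mathfrak{g}'$ (the adjoint group of $\mathfrak{g}'$). *)

(* Defs.v *)
From HB Require Import structures.
From mathcomp Require Import all_boot all_order all_algebra.
From mathcomp Require Import complex.
From mathcomp Require Import all_classical all_reals all_analysis.

Set Implicit Arguments.
Unset Strict Implicit.
Unset Printing Implicit Defensive.

Import Order.TTheory GRing.Theory Num.Theory numFieldNormedType.Exports.

Local Open Scope classical_set_scope.
Local Open Scope ring_scope.

(* The field of complex numbers, seen as a numClosedFieldType so that C and
   the matrices over C receive their usual topology. *)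
Definition CC (R : realType) : numClosedFieldType := R[i].

Section Lie.
Variable C : numClosedFieldType.
Local Notation M := 'M[C]_3.

Definition lie (x y : M) : M := x *m y - y *m x.

Definition ad (x : M) : 'End(M) := linfun (lie x).

Definition sl3 : {vspace M} := lker (linfun (fun x : M => \tr x : C^o)).

Definition lie_subalgebra (g S : {vspace M}) : Prop :=
  (S <= g)%VS /\ (forall x y, x \in S -> y \in S -> lie x y \in S).

Definition is_span (P : M -> Prop) (V : {vspace M}) : Prop :=
  forall W : {vspace M}, (V <= W)%VS <-> (forall x, P x -> x \in W).

Definition ad_diagonalizable (h : M) : Prop :=
  exists2 b : seq M, basis_of sl3 b
    & forall v, v \in b -> exists a : C, lie h v = a *: v.

(* Cartan subalgebra of the semisimple algebra sl3: abelian, equal to its own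
   centralizer, and acting diagonalizably. *)
Definition cartan (H : {vspace M}) : Prop :=
  [/\ (H <= sl3)%VS,
      forall h k, h \in H -> k \in H -> lie h k = 0,
      forall x, x \in sl3 -> (forall h, h \in H -> lie h x = 0) -> x \in H
    & forall h, h \in H -> ad_diagonalizable h].

Section Roots.
Variable H : {vspace M}.

Definition dual_of : vectType C := 'Hom(subvs_of H, C^o).

Definition root_vector (a : dual_of) (x : M) : Prop :=
  [/\ x \in sl3, x != 0
    & forall h : subvs_of H, lie (vsval h) x = (a h : C) *: x].

Definition is_root (a : dual_of) : Prop :=
  a != 0 /\ exists x, root_vector a x.

(* {a1, a2} is a base of the root system (a set of simple roots). *)
Definition simple_roots (a1 a2 : dual_of) : Prop :=
  [/\ is_root a1, is_root a2, basis_of fullv [:: a1; a2]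
    & forall b, is_root b -> exists m n : nat,
        b = a1 *+ m + a2 *+ n \/ b = - (a1 *+ m + a2 *+ n)].

Definition positive_root (a1 a2 b : dual_of) : Prop :=
  is_root b /\ exists m n : nat, b = a1 *+ m + a2 *+ n.

(* The Borel subalgebra determined by H and a1, a2: the sum of H and of the
   root spaces of the positive roots. *)
Definition borel (a1 a2 : dual_of) (g : {vspace M}) : Prop :=
  is_span (fun x => x \in H \/
             exists2 b, positive_root a1 a2 b & root_vector b x) g.

End Roots.

Definition derived_algebra (g g' : {vspace M}) : Prop :=
  is_span (fun z => exists x y, [/\ x \in g, y \in g & z = lie x y]) g'.

(* e^f as the pointwise limit of the partial sums of the exponential series. *)
Definition exp_end (f : 'End(M)) : 'End(M) :=
  linfun (fun y : M =>
    lim ((\sum_(0 <= k < n) (k`!%:R : C)^-1 *: iter k f y) @[n --> \oo])).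

(* The group generated by the e^(ad x), x in g.  Its elements are kept as
   endomorphisms of the ambient matrix space; they restrict to g. *)
Inductive adjoint_group (g : {vspace M}) : 'End(M) -> Prop :=
| adjoint_id : adjoint_group g \1%VF
| adjoint_exp x : x \in g -> adjoint_group g (exp_end (ad x))
| adjoint_comp f1 f2 :
    adjoint_group g f1 -> adjoint_group g f2 -> adjoint_group g (f1 \o f2)%VF
| adjoint_inv f : adjoint_group g f -> adjoint_group g (f^-1)%VF.

Definition conjugate (g S T : {vspace M}) : Prop :=
  exists2 f, adjoint_group g f & (f @: S)%VS = T.

(* The family (rep i) meets each conjugacy class of d-dimensional subalgebras
   of g exactly once; distinct indices give non-conjugate subalgebras. *)
Definition class_representatives (g : {vspace M}) (d : nat)
    (I : Type) (rep : I -> {vspace M}) : Prop :=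
  [/\ forall i, lie_subalgebra g (rep i) /\ \dim (rep i) = d,
      forall S, lie_subalgebra g S -> \dim S = d ->
        exists i, conjugate g S (rep i)
    & forall i j, conjugate g (rep i) (rep j) -> i = j].

Inductive index1 : Type := Line2 | Line12 | Line1 of C.

Definition rep1 (X1 X2 X12 : M) (i : index1) : {vspace M} :=
  match i with
  | Line2 => <[X2]>
  | Line12 => <[X12]>
  | Line1 c => <[X1 + c *: X2]>
  end%VS.

Inductive index2 : Type := Plane2 | Plane1 of C.

Definition rep2 (X1 X2 X12 : M) (i : index2) : {vspace M} :=
  match i with
  | Plane2 => <<[:: X2; X12]>>
  | Plane1 c => <<[:: X12; (X1 + c *: X2)%R]>>
  end%VS.

End Lie.

(* Main.v *)
Require Import Defs.
From HB Require Import structures.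
From mathcomp Require Import all_boot all_order all_algebra.
From mathcomp Require Import complex.
From mathcomp Require Import all_classical all_reals all_analysis.
From mathcomp Require Import ring.
Import Order.TTheory GRing.Theory Num.Theory numFieldNormedType.Exports.
Local Open Scope ring_scope.

(* An element h of a Cartan subalgebra is diagonalizable as a matrix because
   sl3 moves one eigenvector of h onto a spanning set of eigenvectors.  Hence
   the Cartan subalgebra is, in a suitable basis P, the traceless diagonal
   matrices, roots are differences of diagonal entries, and simple roots occupy
   entries (i, j), (j, k) up to swapping them.  The three positive root vectors
   then satisfy the Heisenberg relations, with X12 central.  Elements of g' are
   nilpotent matrices, so e^(ad x) is a finite sum, and on g' it is y + [x, y]:
   the adjoint group fixes X12 and acts trivially modulo X12.  This separates the
   representatives; conversely the X12-coordinate of any line other than <X12>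
   can be moved to 0, and every plane subalgebra contains X12. *)

(** * The bracket on 3 by 3 matrices, [ad] and [sl3] *)

Section LieBasics.
Variable C : numClosedFieldType.
Local Notation M := 'M[C]_3.
Implicit Types x y z h : M.

(** Bare functions such as [lie x] or the exponential limit carry no canonical linear structure;
    here linearity enters as a proof and is packed into one. *)
Lemma linfunE (K : nzRingType) (U V : vectType K) (f : U -> V) :
  linear f -> linfun f =1 f.
Proof.
move=> lf; pose L := GRing.isLinear.Build K U V *:%R f lf.
pose F : {linear U -> V} := HB.pack f L.
exact: (lfunE F).
Qed.

Lemma lie_linear x : linear (lie x).
Proof.
move=> a y z; rewrite /lie mulmxDr mulmxDl -scalemxAr -scalemxAl scalerBr.
by rewrite opprD addrACA.
Qed.

Lemma lieC x y : lie y x = - lie x y.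
Proof. by rewrite /lie opprB. Qed.

Lemma liexx x : lie x x = 0.
Proof. exact: subrr. Qed.

Lemma lieDr x y z : lie x (y + z) = lie x y + lie x z.
Proof. by rewrite -[y in LHS]scale1r lie_linear scale1r. Qed.

Lemma lie0r x : lie x 0 = 0.
Proof. by rewrite /lie mulmx0 mul0mx subrr. Qed.

Lemma lieZr x a y : lie x (a *: y) = a *: lie x y.
Proof. by rewrite -[a *: y]addr0 lie_linear lie0r addr0. Qed.

Lemma lieDl x y z : lie (y + z) x = lie y x + lie z x.
Proof. by rewrite lieC lieDr opprD -!lieC. Qed.

Lemma lieZl x a y : lie (a *: y) x = a *: lie y x.
Proof. by rewrite lieC lieZr -scalerN -lieC. Qed.

Lemma adE x y : ad x y = lie x y.
Proof. exact/linfunE/lie_linear. Qed.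

Lemma mem_sl3 x : (x \in sl3 C) = (\tr x == 0).
Proof.
rewrite memv_ker linfunE // => a y z.
exact: (linearP (@mxtrace C 3)).
Qed.

End LieBasics.

(** * The exponential of [ad x] for a matrix [x] of cube zero *)

Section NilpotentExponential.
Local Open Scope classical_set_scope.
Variable C : numClosedFieldType.
Local Notation M := 'M[C]_3.
Variable x : M.
Hypothesis x3 : x *m x *m x = 0.

Lemma ad_nilpotent (y : M) n : (5 <= n)%N -> iter n (ad x) y = 0.
Proof.
have xX i : (3 <= i)%N -> x ^+ i = 0.
  move=> i3; rewrite -(subnK i3) exprD.
  by rewrite [x ^+ 3]exprS expr2 [x * _]mulrA [x * x * x]x3 mulr0.
(* Each [ad x] puts one more factor [x] on the left or on the right of [y], so outer powers are
   carried along in the induction. A total of five factors forces at least three on one side. *)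
suff K i j : (5 <= i + j + n)%N -> x ^+ i * iter n (ad x) y * x ^+ j = 0.
  by move=> n5; have := K 0 0 n5; rewrite !expr0 mul1r mulr1.
elim: n i j => [|n IH] i j; last first.
  rewrite addnS => le5 /=; rewrite adE /lie mulrBr mulrBl !mulrA -exprSr.
  by rewrite -[_ * x * _]mulrA -exprS !IH ?subrr ?addSn ?addnS.
rewrite addn0 => le5; have [i3|i3] := leqP 3 i; first by rewrite xX ?mul0r.
by rewrite (xX j) ?mulr0 // -(leq_add2l 2) (leq_trans le5) ?leq_add2r.
Qed.

Lemma exp_endE (y : M) :
  exp_end (ad x) y = \sum_(0 <= k < 5) (k`!%:R : C)^-1 *: iter k (ad x) y.
Proof.
pose F (y : M) := \sum_(0 <= k < 5) (k`!%:R : C)^-1 *: iter k (ad x) y.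
suff E : (fun y : M =>
    lim ((\sum_(0 <= k < n) (k`!%:R : C)^-1 *: iter k (ad x) y) @[n --> \oo]))
  = F.
  rewrite /exp_end E linfunE // => a u v.
  rewrite /F scaler_sumr -big_split; apply: eq_bigr => k _.
  have -> : iter k (ad x) (a *: u + v) = a *: iter k (ad x) u + iter k (ad x) v.
    by elim: k => //= k ->; rewrite linearP.
  by rewrite scalerDr !scalerA mulrC.
(* The partial sums are constant from index 5 on, so their limit is that constant. *)
apply: funext => z; apply: lim_near_cst; first exact: norm_hausdorff.
exists 5%N => // n /= n5; rewrite /F (big_cat_nat _ n5) //=.
rewrite [X in _ + X]big1_seq ?addr0 // => k /=.
rewrite mem_index_iota => /andP[k5 _].
by rewrite ad_nilpotent ?scaler0.
Qed.

(** Suppose the exponential kills a nonzero [y], and let [m.+1] be the least number of iterations of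
    [ad x] killing [y]. Applying [iter m (ad x)] to the series leaves only its first term,
    [iter m (ad x) y], which must then vanish, against minimality. Injectivity is what makes [f^-1]
    in [adjoint_inv] a true inverse. *)
Lemma exp_end_lker : lker (exp_end (ad x)) == 0%VS.
Proof.
rewrite -subv0; apply/subvP => y; rewrite memv_ker memv0 => /eqP y0.
have : exists m, iter m (ad x) y == 0 by exists 5%N; rewrite ad_nilpotent.
move=> /ex_minnP[[|m] //= /eqP m1 mmin].
have := congr1 (iter m (ad x)) y0; rewrite exp_endE.
have iter0 j : iter j (ad x) 0 = 0 by elim: j => //= j ->; rewrite linear0.
have iterL a u v : iter m (ad x) (a *: u + v) =
    a *: iter m (ad x) u + iter m (ad x) v.
  by elim: (m) => //= k ->; rewrite linearP.
rewrite iter0 big_nat_recl // iterL /= fact0 invr1 scale1r => my0.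
suff /eqP/mmin : iter m (ad x) y = 0 by rewrite ltnn.
rewrite -[LHS]addr0 -[RHS]my0; congr (_ + _).
apply/esym; elim: (4%N) => [|k IH]; first by rewrite big_nil iter0.
rewrite big_nat_recr //= addrC iterL IH addr0 -iterS -iterD addnS -addSn.
by rewrite addnC iterD [iter m.+1 _ _]m1 iter0 scaler0.
Qed.
End NilpotentExponential.

Lemma mem_span2 (K : fieldType) (V : vectType K) (u v y : V) :
  reflect (exists k l, y = k *: u + l *: v) (y \in <<[:: u; v]>>%VS).
Proof.
rewrite span_cons span_seq1; apply: (iffP memv_addP) => [[_ /vlineP[k ->]]|].
  by case=> _ /vlineP[l ->] ->; exists k, l.
case=> k [l ->]; exists (k *: u); first by apply/vlineP; exists k.
by exists (l *: v) => //; apply/vlineP; exists l.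
Qed.

(** * Coordinates and the adjoint group on the Heisenberg algebra *)

Section HeisenbergTriple.
Variable C : numClosedFieldType.
Local Notation M := 'M[C]_3.

(** Matrix products are recorded, not only brackets, since nilpotency of the matrices depends on
    them. The bracket of [X1] and [X2] is [(p - q) *: X12], nonzero by [heis_neq]; keeping both [p]
    and [q] makes the notion symmetric in [X1] and [X2]. *)
Record heisenberg_triple (X1 X2 X12 : M) (p q : C) : Prop := HeisenbergTriple {
  heis_free : free [:: X1; X2; X12];
  heis11 : X1 *m X1 = 0;
  heis22 : X2 *m X2 = 0;
  heis1212 : X12 *m X12 = 0;
  heis1_12 : X1 *m X12 = 0;
  heis12_1 : X12 *m X1 = 0;
  heis2_12 : X2 *m X12 = 0;
  heis12_2 : X12 *m X2 = 0;
  heis1_2 : X1 *m X2 = p *: X12;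
  heis2_1 : X2 *m X1 = q *: X12;
  heis_neq : p != q }.

Variables (X1 X2 X12 : M) (p q : C).
Hypothesis X_heis : heisenberg_triple X1 X2 X12 p q.

Let N : {vspace M} := <<[:: X1; X2; X12]>>%VS.
Let cb (a b d : C) : M := a *: X1 + b *: X2 + d *: X12.

Lemma heis_memP y : reflect (exists a b d, y = cb a b d) (y \in N).
Proof.
rewrite /N span_cons; apply: (iffP memv_addP) => [[_ /vlineP[a ->]]|].
  by case=> _ /mem_span2[b [d ->]] ->; exists a, b, d; rewrite /cb addrA.
case=> a [b [d ->]]; exists (a *: X1); first by apply/vlineP; exists a.
by exists (b *: X2 + d *: X12); rewrite ?addrA //; apply/mem_span2; exists b, d.
Qed.

Lemma heis_inj a b d a' b' d' :
  cb a b d = cb a' b' d' -> [/\ a = a', b = b' & d = d'].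
Proof.
move=> /eqP; rewrite -subr_eq0 => /eqP E.
case: X_heis => /(@freeP _ _ 3 [tuple X1; X2; X12]) F _ _ _ _ _ _ _ _ _ _.
have Z : \sum_(i < 3) [tuple a - a'; b - b'; d - d']`_i *: [tuple X1; X2; X12]`_i = 0.
  rewrite -[RHS]E !big_ord_recl big_ord0 /= /cb !scalerBl.
  by rewrite !opprD addr0 addrA [RHS]addrACA [X in _ = X + _]addrACA.
have S i := F _ Z i.
have := (S 0, S 1, S (inord 2)); rewrite /= inordK //=.
by case=> [[/eqP + /eqP +] /eqP]; rewrite !subr_eq0 => /eqP-> /eqP-> /eqP->.
Qed.

Lemma heis_mul a b d a' b' d' :
  cb a b d *m cb a' b' d' = (a * b' * p + b * a' * q) *: X12.
Proof.
case: X_heis => _ e1 e2 e3 e4 e5 e6 e7 e8 e9 _.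
rewrite /cb !mulmxDl !mulmxDr -!scalemxAl -!scalemxAr e1 e2 e3 e4 e5 e6 e7 e8 e9.
by rewrite !scaler0 !(add0r, addr0) !scalerA -scalerDl.
Qed.

Lemma heis_lie a b d a' b' d' :
  lie (cb a b d) (cb a' b' d') = cb 0 0 ((a * b' - b * a') * (p - q)).
Proof.
rewrite /lie !heis_mul -scalerBl /cb !scale0r !add0r; congr (_ *: _); ring.
Qed.

Lemma heis_scale k a b d : k *: cb a b d = cb (k * a) (k * b) (k * d).
Proof. by rewrite /cb !scalerDr !scalerA. Qed.

Lemma heis_add a b d a' b' d' :
  cb a b d + cb a' b' d' = cb (a + a') (b + b') (d + d').
Proof. by rewrite /cb !scalerDl addrACA [X in X + _ = _]addrACA. Qed.

Lemma heis_cube x : x \in N -> x *m x *m x = 0.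
Proof.
move=> /heis_memP[a [b [d ->]]]; rewrite heis_mul.
have -> k : k *: X12 = cb 0 0 k by rewrite /cb !scale0r !add0r.
by rewrite heis_mul !mul0r add0r scale0r.
Qed.

(** Brackets of elements of [N] are multiples of [X12], which is central, so the series stops after
    its linear term. *)
Lemma heis_exp x a b d : x \in N -> exp_end (ad x) (cb a b d) =
  cb a b d + lie x (cb a b d).
Proof.
move=> xN; rewrite exp_endE; last exact: heis_cube.
have Z : lie x (lie x (cb a b d)) = 0.
  have /heis_memP[a' [b' [d' ->]]] := xN; rewrite !heis_lie.
  by rewrite !mulr0 subrr mul0r /cb !scale0r !addr0.
rewrite !big_nat_recl // big_nil /= !adE Z !lie0r !scaler0 !addr0.
by rewrite !fact0 invr1 !scale1r.
Qed.

(** These three invariants are proved together by induction on the group: the inverse case uses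
    injectivity and the fixed vector [X12] to transfer the third one. *)
Lemma heis_adjoint f : adjoint_group N f -> [/\ lker f == 0%VS, f X12 = X12
  & forall a b d, exists e, f (cb a b d) = cb a b e].
Proof.
have X12E : X12 = cb 0 0 1 by rewrite /cb !scale0r !add0r scale1r.
elim=> {f} [|x xN|f1 f2 _ [k1 f1X f1cb] _ [k2 f2X f2cb]|f _ [k fX fcb]].
- split=> [||a b d]; rewrite ?id_lfunE //; last by exists d.
  by apply/lker0P => u v; rewrite !id_lfunE.
- split=> [||a b d].
  + by apply: exp_end_lker; apply: heis_cube.
  + rewrite X12E heis_exp // -X12E; have /heis_memP[a' [b' [d' ->]]] := xN.
    by rewrite X12E heis_lie !mulr0 subrr mul0r /cb !scale0r !addr0.
  + rewrite heis_exp //; have /heis_memP[a' [b' [d' ->]]] := xN.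
    by rewrite heis_lie heis_add !addr0; eexists.
- split=> [||a b d].
  + apply/lker0P => u v; rewrite !comp_lfunE.
    by move/(lker0P k1)/(lker0P k2).
  + by rewrite comp_lfunE f2X f1X.
  + have [e f2e] := f2cb a b d.
    have [e' fe'] := f1cb a b e; exists e'.
    by rewrite comp_lfunE f2e.
- have fK := lker0_lfunK k; have fVK := lker0_lfunVK k.
  split=> [||a b d].
  + by apply/lker0P => u v /(congr1 f); rewrite !fVK.
  + by rewrite -{1}fX fK.
  (* [f] shifts the last coordinate by [e - d]. Since [f] fixes [X12], subtracting this shift
     beforehand gives the preimage of [cb a b d]. *)
  + have [e fe] := fcb a b d; exists (d - (e - d)).
    suff <- : f (cb a b (d - (e - d))) = cb a b d by rewrite fK.
    have -> : cb a b (d - (e - d)) = cb a b d - (e - d) *: X12.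
      by rewrite /cb scalerBl addrA.
    rewrite linearB linearZ /= fe fX /cb -addrA -scalerBl.
    by congr (_ + _ *: _); ring.
Qed.

Lemma heis_line_conjugate x y z k : x \in N -> k != 0 ->
  exp_end (ad x) y = k *: z -> conjugate N <[y]>%VS <[z]>%VS.
Proof.
move=> xN k0 E; exists (exp_end (ad x)); first exact: adjoint_exp.
rewrite limg_line E; apply/eqP; rewrite eqEsubv; apply/andP; split.
  by apply/subvP => _ /vlineP[l ->]; rewrite scalerA; apply/vlineP; exists (l * k).
apply/subvP => _ /vlineP[l ->]; apply/vlineP; exists (l / k).
by rewrite scalerA divfK.
Qed.

(** * Conjugacy classes of lines *)

Let vec1 (i : index1 C) : M :=
  match i with
  | Line2 => cb 0 1 0
  | Line12 => cb 0 0 1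
  | Line1 c => cb 1 c 0
  end.

Lemma rep1E i : rep1 X1 X2 X12 i = <[vec1 i]>%VS.
Proof. by case: i => [||c] /=; rewrite /cb ?scale0r ?scale1r ?add0r ?addr0. Qed.

Lemma heis_eq0 a b d : (cb a b d == 0) = [&& a == 0, b == 0 & d == 0].
Proof.
apply/eqP/and3P => [|[/eqP-> /eqP-> /eqP->]]; last first.
  by rewrite /cb !scale0r !addr0.
have -> : 0 = cb 0 0 0 by rewrite /cb !scale0r !addr0.
by case/heis_inj => -> -> ->; rewrite eqxx.
Qed.

Lemma heis_mem a b d : cb a b d \in N.
Proof. by apply/heis_memP; exists a, b, d. Qed.

Lemma heis_representatives1 : class_representatives N 1 (rep1 X1 X2 X12).
Proof.
split=> [i|S [SN _] dS|i j].
- rewrite rep1E dim_vline; split; last first.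
    by case: i => [||c] /=; rewrite heis_eq0 oner_eq0 ?andbF.
  split.
    by rewrite -memvE; case: i => [||c]; apply: heis_mem.
  move=> _ _ /vlineP[k ->] /vlineP[l ->].
  by rewrite lieZl lieZr liexx !scaler0 mem0v.
- set y := vpick S.
  have y0 : y != 0 by rewrite vpick0 -dimv_eq0 dS.
  have yS : y \in S by apply: memv_pick.
  have -> : S = <[y]>%VS.
    by apply/esym/eqP; rewrite eqEdim -memvE yS dS dim_vline y0.
  have /heis_memP[a [b [d yE]]] := subvP SN _ yS; rewrite yE heis_eq0 in y0 *.
  have pq : p - q != 0 by case: X_heis => *; rewrite subr_eq0.
  have [a0|a0] := eqVneq a 0; first have [b0|b0] := eqVneq b 0.
  + exists (Line12 C); rewrite rep1E /=; have dN0 : d != 0.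
      by move: y0; rewrite a0 b0 !eqxx.
    apply: (@heis_line_conjugate (cb 0 0 0) _ _ d) => //.
      exact: heis_mem.
    rewrite heis_exp ?heis_mem // heis_lie heis_add heis_scale a0 b0.
    by congr cb; ring.
  + exists (Line2 C); rewrite rep1E /=.
    (* Bracketing [cb s 0 0] with [cb 0 b d] gives [s * b * (p - q)] times [X12]; this [s] cancels
       [d]. In the next case [cb 0 t 0] contributes [- t * a * (p - q)], which determines [t]
       likewise. *)
    apply: (@heis_line_conjugate (cb (- d / (b * (p - q))) 0 0) _ _ b) => //.
      exact: heis_mem.
    rewrite heis_exp ?heis_mem // heis_lie heis_add heis_scale a0.
    by congr cb; field; rewrite ?pq.
  + exists (Line1 (b / a)); rewrite rep1E /=.
    apply: (@heis_line_conjugate (cb 0 (d / (a * (p - q))) 0) _ _ a) => //.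
      exact: heis_mem.
    rewrite heis_exp ?heis_mem // heis_lie heis_add heis_scale.
    by congr cb; field; rewrite ?pq.
(* The first two coordinates of [vec1 i] survive [f], so they are [k] times those of [vec1 j]; for
   [Line12] the fixed vector [X12] itself is compared. The normalization of the generators then
   forces equal indices. *)
- case=> f /heis_adjoint[_ fX fcb]; rewrite !rep1E limg_line => E.
  have /vlineP[k] : f (vec1 i) \in <[vec1 j]>%VS by rewrite -E memv_line.
  have n10 : 1 <> 0 :> C by move/eqP; rewrite oner_eq0.
  case: i {E} => [||c] /=.
  + have [e ->] := fcb 0 1 0; case: j => [||c'] //=; rewrite heis_scale;
      case/heis_inj; rewrite ?mulr0 ?mulr1 // => <-.
    by rewrite mul0r => /n10.
  + have -> : cb 0 0 1 = X12 by rewrite /cb !scale0r !add0r scale1r.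
    rewrite fX; have -> : X12 = cb 0 0 1 by rewrite /cb !scale0r !add0r scale1r.
    by case: j => [||c'] //=; rewrite heis_scale => /heis_inj[];
      rewrite ?mulr0 ?mulr1 // => _ _ /n10.
  + have [e ->] := fcb 1 c 0; case: j => [||c'] //=; rewrite heis_scale;
      case/heis_inj; rewrite ?mulr0 ?mulr1 => k1 ck _; try by case: (n10 k1).
    by rewrite ck -k1 mul1r.
Qed.

(** * Conjugacy classes of planes, each written as [X12] and one further generator *)

Let vec2 (i : index2 C) : M :=
  match i with
  | Plane2 => cb 0 1 0
  | Plane1 c => cb 1 c 0
  end.

Lemma rep2E i : rep2 X1 X2 X12 i = <<[:: X12; vec2 i]>>%VS.
Proof.
case: i => [|c] /=; last by rewrite /cb scale1r scale0r addr0.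
rewrite /cb scale1r !scale0r addr0 add0r.
by apply: eq_span => z; rewrite !inE orbC.
Qed.

Lemma heis_dim_plane i : \dim <<[:: X12; vec2 i]>> = 2%N.
Proof.
apply/eqP; rewrite -[X in _ == X]/(size [:: X12; vec2 i]) -/(free _) free_cons.
rewrite seq1_free span_seq1.
have -> : X12 = cb 0 0 1 by rewrite /cb !scale0r !add0r scale1r.
apply/andP; split; last first.
  by case: i => [|c] /=; rewrite heis_eq0 oner_eq0 ?andbF.
apply/negP => /vlineP[k]; case: i => [|c] /=; rewrite heis_scale;
  by case/heis_inj => _ _ /eqP; rewrite mulr0 oner_eq0.
Qed.

(** For a basis [y], [z] of [S], let [D] be the determinant of their first two coordinates. If [D]
    is nonzero, the bracket of [y] and [z] is a nonzero multiple of [X12]. Otherwise these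
    coordinates are dependent, and some nontrivial combination of [y] and [z] lies on the line of
    [X12]. *)
Lemma heis_center_mem S : lie_subalgebra N S -> \dim S = 2%N -> X12 \in S.
Proof.
move=> [SN Slie] dS.
have X12Z k : k != 0 -> k *: X12 \in S -> X12 \in S.
  by move=> k0 /(memvZ k^-1); rewrite scalerA mulVf // scale1r.
have cbZ k : cb 0 0 k = k *: X12 by rewrite /cb !scale0r !add0r.
have [b bS] : exists b : 2.-tuple M, basis_of S b.
  by move: (vbasis S) (vbasisP S); rewrite dS => b bS; exists b.
have [y yE] : exists y, y = b`_0 by exists b`_0.
have [z zE] : exists z, z = b`_1 by exists b`_1.
have yS : y \in S by rewrite yE (basis_mem bS) ?mem_nth ?size_tuple.
have zS : z \in S by rewrite zE (basis_mem bS) ?mem_nth ?size_tuple.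
have yz k l : k *: y + l *: z = 0 -> k = 0 /\ l = 0.
  have /freeP F := basis_free bS.
  move=> E; have := F (fun i : 'I_2 => if i == 0 then k else l).
  rewrite !big_ord_recl big_ord0 /= addr0 -yE -zE E => /(_ erefl) G.
  by split; [exact: (G 0)|exact: (G 1)].
have /heis_memP[a1 [b1 [d1 Ey]]] := subvP SN _ yS.
have /heis_memP[a2 [b2 [d2 Ez]]] := subvP SN _ zS.
have pq : p - q != 0 by case: X_heis => *; rewrite subr_eq0.
have [D|D] := eqVneq (a1 * b2 - b1 * a2) 0; last first.
  apply: (X12Z _ (mulf_neq0 D pq)); rewrite -cbZ -(heis_lie _ _ d1 _ _ d2) -Ey -Ez; exact: Slie.
have comb k l : k *: y + l *: z = cb (k * a1 + l * a2) (k * b1 + l * b2) (k * d1 + l * d2).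
  by rewrite Ey Ez !heis_scale heis_add.
have combS k l : k *: y + l *: z \in S by rewrite memvD ?memvZ.
(* A combination whose first two coordinates vanish is a multiple of [X12]: a nonzero multiple puts
   [X12] in [S], and a zero one has trivial coefficients by independence. *)
have key k l : k * a1 + l * a2 = 0 -> k * b1 + l * b2 = 0 -> 
    (X12 \in S) \/ (k = 0 /\ l = 0).
  move=> Ka Kb; have := combS k l; have := yz k l; rewrite comb Ka Kb cbZ.
  have [->|d0] := eqVneq (k * d1 + l * d2) 0; last by move=> _ /(X12Z _ d0); left.
  by rewrite scale0r => /(_ erefl); right.
(* As [D = 0], the coefficient pairs [(a2, - a1)] and [(b2, - b1)] both kill the first two
   coordinates. If both pairs are trivial, [y] itself is a multiple of [X12], which the pair
   [(1, 0)] exploits. *)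
have [|||[a20 a10]] // := key a2 (- a1).
- ring.
- by rewrite -[RHS]oppr0 -D; ring.
have [|||[b20 b10]] // := key b2 (- b1).
- by rewrite -D; ring.
- ring.
have a1E : a1 = 0 by rewrite -[a1]opprK a10 oppr0.
have b1E : b1 = 0 by rewrite -[b1]opprK b10 oppr0.
have [|||[/eqP]] // := key 1 0; rewrite ?oner_eq0 //.
- by rewrite a1E mulr0 mul0r addr0.
- by rewrite b1E mulr0 mul0r addr0.
Qed.

Lemma heis_representatives2 : class_representatives N 2 (rep2 X1 X2 X12).
Proof.
have X12E : X12 = cb 0 0 1 by rewrite /cb !scale0r !add0r scale1r.
have eq_plane i (S : {vspace M}) : X12 \in S -> vec2 i \in S -> \dim S = 2%N ->
    S = <<[:: X12; vec2 i]>>%VS.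
  move=> XS vS dS; apply/esym/eqP; rewrite eqEdim heis_dim_plane dS leqnn andbT.
  by apply/span_subvP => z; rewrite !inE => /orP[] /eqP->.
split=> [i|S hS dS|i j].
- rewrite rep2E heis_dim_plane; split=> //; split.
    apply/span_subvP => z; rewrite !inE => /orP[] /eqP->.
      by rewrite X12E heis_mem.
    by case: i => [|c]; apply: heis_mem.
  move=> _ _ /mem_span2[k [l ->]] /mem_span2[k' [l' ->]].
  apply/mem_span2.
  have [a [b vE]] : exists a b, vec2 i = cb a b 0.
    by case: i => [|c]; do 2!eexists.
  rewrite vE X12E !heis_scale !heis_add heis_lie.
  eexists; exists 0; rewrite scale0r addr0 heis_scale !mulr0 mulr1; reflexivity.
(* A plane subalgebra is equal to a representative, so the identity conjugates: it contains [X12],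
   and any other vector of it can be stripped of its [X12] part and rescaled to some [vec2 i]. *)
- have XS := heis_center_mem _ hS dS; have [SN _] := hS.
  suff [i vS] : exists i, vec2 i \in S.
    exists i; exists \1%VF; first exact: adjoint_id.
    by rewrite rep2E lim1g; apply: eq_plane.
  have [y yS yX] : exists2 y, y \in S & y \notin <[X12]>%VS.
    apply/subvPn; apply/negP => /dimvS; rewrite dS dim_vline.
    by case: (X12 != 0).
  have /heis_memP[a [b [d yE]]] := subvP SN _ yS.
  have abS : cb a b 0 \in S.
    suff -> : cb a b 0 = y - d *: X12 by rewrite memvB ?memvZ.
    by rewrite yE /cb scale0r addr0 addrK.
  have [a0|a0] := eqVneq a 0; last first.
    exists (Plane1 (b / a)); have := memvZ a^-1 abS.
    by rewrite heis_scale mulVf // mulr0 mulrC.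
  have b0 : b != 0.
    apply: contraNneq yX => b0; apply/vlineP; exists d.
    by rewrite yE a0 b0 /cb !scale0r !add0r.
  exists (Plane2 C); have := memvZ b^-1 abS.
  by rewrite heis_scale mulVf // mulr0 a0 mulr0.
(* Modulo [X12] the map [f] is the identity, so [vec2 i] is a multiple of [vec2 j] modulo [X12]. *)
- case=> f /heis_adjoint[_ _ fcb]; rewrite !rep2E => E.
  have : f (vec2 i) \in <<[:: X12; vec2 j]>>%VS.
    by rewrite -E memv_img // memv_span // !inE eqxx orbT.
  have n10 : 1 <> 0 :> C by move/eqP; rewrite oner_eq0.
  case/mem_span2 => k [l]; rewrite X12E.
  case: i {E} => [|c] /=.
    have [e ->] := fcb 0 1 0; case: j => [|c'] //=; rewrite !heis_scale heis_add.
    case/heis_inj; rewrite !mulr0 !add0r mulr1 => <-.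
    by rewrite mul0r => /n10.
  have [e ->] := fcb 1 c 0; case: j => [|c'] //=; rewrite !heis_scale heis_add;
    case/heis_inj; rewrite !mulr0 !add0r ?mulr1 => k1 ck _; first by case: (n10 k1).
  by rewrite ck -k1 mul1r.
Qed.
End HeisenbergTriple.

(** * Simultaneous diagonalization of a Cartan subalgebra *)

Section Diagonalization.
Variable C : numClosedFieldType.
Local Notation M := 'M[C]_3.
Implicit Types (x y z h : M) (i j k : 'I_3).

Lemma ord3_exists_neq i : exists j, j != i.
Proof. by exists (if i == 0 then 1 else 0); case: (eqVneq i 0) => [->|]; rewrite // eq_sym. Qed.

Lemma mxtrace_delta i j : \tr (delta_mx i j : M) = (i == j)%:R.
Proof.
rewrite /mxtrace (bigD1 i) //= mxE eqxx big1 ?addr0 //= => k ki.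
by rewrite mxE (negPf ki).
Qed.

Lemma delta_sl3 i j : i != j -> delta_mx i j \in sl3 C.
Proof. by rewrite mem_sl3 mxtrace_delta => /negPf->. Qed.

Lemma delta_sub_sl3 i j : delta_mx i i - delta_mx j j \in sl3 C.
Proof. by rewrite mem_sl3 raddfB /= !mxtrace_delta !eqxx subrr. Qed.

Lemma row_delta (v : 'rV[C]_3) i j : v *m delta_mx i j = v 0 i *: delta_mx 0 j.
Proof.
apply/rowP => k; rewrite !mxE (bigD1 i) //= mxE !eqxx big1 ?addr0 // => l li.
by rewrite mxE (negPf li) mulr0.
Qed.

(** If the entry [v 0 i] is nonzero, [delta_mx i j] sends [v] to a nonzero multiple of the [j]-th
    basis row for each [j != i]. The [i]-th one then comes from [delta_mx i i - delta_mx k k]. *)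
Lemma sl3_row_full (W : M) (v : 'rV[C]_3) : v != 0 ->
  (forall x, x \in sl3 C -> (v *m x <= W)%MS) -> (1%:M <= W)%MS.
Proof.
move=> /rV0Pn[i vi] vW.
have eW j : j != i -> ((delta_mx 0 j : 'rV[C]_3) <= W)%MS.
  move=> ji; have := vW _ (delta_sl3 _ _ (_ : i != j)); rewrite eq_sym => /(_ ji).
  by rewrite row_delta (eqmx_scale _ vi).
apply/row_subP => j; rewrite row1.
have [->|/eW //] := eqVneq j i.
have [k ki] := ord3_exists_neq i.
have := vW _ (delta_sub_sl3 i k); rewrite mulmxBr !row_delta => dW.
rewrite -(eqmx_scale _ vi) -[X in (X <= _)%MS](subrK (v 0 k *: delta_mx 0 k)).
by rewrite addmx_sub // scalemx_sub // eW.
Qed.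

(* If v is an eigenvector of h and x one of ad h, then v x is again an
   eigenvector of h; these rows span because v sl3 is the whole row space. *)
Lemma ad_diagonalizable_diagonalizable h :
  ad_diagonalizable h -> diagonalizable h.
Proof.
move=> [b b_basis b_eig].
have [m /eigenvalueP[v vh v0]] := eigenvalue_closed h isT.
have /choice[c cP] x : exists a, x \in b -> lie h x = a *: x.
  by case: (boolP (x \in b)) => [/b_eig[a]|_]; [exists a|exists 0].
(* If [v h = m v] and [[h, x] = c x], then [v x h = v h x - c v x = (m - c) v x]. *)
pose rs := undup [seq m - c x | x <- b].
apply/diagonalizablePeigen; exists rs; first exact: undup_uniq.
apply/eqmxP; rewrite submx1 /=; apply: (sl3_row_full _ _ v0) => x.
rewrite -(span_basis b_basis) => /(@coord_span _ _ _ (in_tuple b)) ->.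
rewrite mulmx_sumr summx_sub // => i _.
rewrite -scalemxAr scalemx_sub //; set y := _`_i.
have yb : y \in b by rewrite mem_nth.
rewrite (big_rem (m - c y)) /=; last by rewrite mem_undup; apply/mapP; exists y.
apply: (submx_trans _ (addsmxSl _ _)); apply/eigenspaceP.
have := cP _ yb; rewrite /lie => /eqP; rewrite subr_eq addrC -subr_eq => /eqP E.
by rewrite -mulmxA -E mulmxBr mulmxA vh -scalemxAl -scalemxAr scalerBl.
Qed.

(** The basis elements of [H] are diagonalizable and commute, hence share a diagonalizing [P]; being
    diagonal passes to linear combinations. *)
Lemma cartan_codiagonalizable (H : {vspace M}) : cartan H ->
  exists2 P : M, P \in unitmx &
    forall h, h \in H -> is_diag_mx (P *m h *m invmx P).
Proof.
move=> [_ Hab _ Hdiag].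
have [|P Pu /allP Pd] := (codiagonalizableP (vbasis H)).1.
  split=> [h k /vbasis_mem hH /vbasis_mem kH|h /vbasis_mem/Hdiag].
    by apply/eqP; rewrite -subr_eq0; apply/eqP/Hab.
  exact: ad_diagonalizable_diagonalizable.
exists P => // h /coord_vbasis ->.
rewrite mulmx_sumr mulmx_suml; apply/is_diag_mxP => i j ij.
rewrite summxE big1 // => k _; rewrite -scalemxAr -scalemxAl mxE.
have /Pd/= : (vbasis H)`_k \in vbasis H by rewrite mem_nth ?size_tuple.
by rewrite /similar_to conjumx // => /is_diag_mxP ->; rewrite ?mulr0.
Qed.

(** Diagonal matrices commute with the diagonalized [H], and [H] is its own centralizer in [sl3]. *)
Lemma cartan_mem (H : {vspace M}) (P : M) : cartan H -> P \in unitmx ->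
  (forall h, h \in H -> is_diag_mx (P *m h *m invmx P)) ->
  forall d : 'rV[C]_3, \sum_i d 0 i = 0 -> invmx P *m diag_mx d *m P \in H.
Proof.
move=> [_ _ Hself _] Pu Pd d d0; apply: Hself => [|h hH].
  by rewrite mem_sl3 -mulmxA mxtrace_mulC -mulmxA mulmxV // mulmx1 mxtrace_diag d0.
have /diag_mxP[e E] := Pd _ hH.
have -> : h = invmx P *m diag_mx e *m P by rewrite -E !mulmxA mulVmx // mul1mx mulmxKV.
rewrite /lie !mulmxA !(mulmxK Pu) -!(mulmxA (invmx P)) diag_mxC.
by rewrite subrr.
Qed.
End Diagonalization.

(** * Roots and root vectors in the diagonalizing basis *)

Section Roots.
Variable C : numClosedFieldType.
Local Notation M := 'M[C]_3.
Implicit Types (x y z h : M) (i j k l : 'I_3).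
Variables (H : {vspace M}) (P : M).
Hypothesis P_unit : P \in unitmx.
Hypothesis P_diag : forall h, h \in H -> is_diag_mx (P *m h *m invmx P).
Hypothesis P_mem : forall d : 'rV[C]_3,
  \sum_i d 0 i = 0 -> invmx P *m diag_mx d *m P \in H.

Let wt i h : C := (P *m h *m invmx P) i i.
Let E i j : M := invmx P *m delta_mx i j *m P.
(** This is the root commonly written as epsilon_i - epsilon_j, whose root vector is the transported
    matrix unit [E i j]. *)
Let has_wt (a : dual_of H) i j :=
  forall h : subvs_of H, a h = wt i (vsval h) - wt j (vsval h).

Lemma conj_lie h x i j : h \in H ->
  (P *m lie h x *m invmx P) i j = (wt i h - wt j h) * (P *m x *m invmx P) i j.
Proof.
move=> /P_diag/diag_mxP[e he].
have conjM y z : P *m (y *m z) *m invmx P =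
    (P *m y *m invmx P) *m (P *m z *m invmx P).
  by rewrite !mulmxA mulmxKV.
rewrite /wt /lie mulmxBr mulmxBl !conjM he mul_diag_mx mul_mx_diag !mxE !eqxx.
by rewrite !mulr1n mulrBl [X in _ - X]mulrC.
Qed.

Lemma E_mul i j k l : E i j *m E k l = (j == k)%:R *: E i l.
Proof.
rewrite /E !mulmxA mulmxK // -(mulmxA _ (delta_mx i j)) mul_delta_mx_cond.
by rewrite -scaler_nat -scalemxAr -scalemxAl.
Qed.
Lemma conj_E i j : P *m E i j *m invmx P = delta_mx i j.
Proof. by rewrite /E !mulmxA mulmxV // mul1mx mulmxK. Qed.

Lemma conj_inj x y : P *m x *m invmx P = P *m y *m invmx P -> x = y.
Proof.
by move=> /(congr1 (fun z => invmx P *m z *m P)); rewrite !mulmxA mulVmx // !mul1mx !mulmxKV.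
Qed.

Lemma conj_diag d i : wt i (invmx P *m diag_mx d *m P) = d 0 i.
Proof. by rewrite /wt !mulmxA mulmxV // mul1mx mulmxK // mxE eqxx. Qed.

(** Evaluate at the element of [H] with diagonal entries 1 at [i], -1 at [j] and 0 elsewhere: the
    left side is 2, and the right side reaches 2 only for [k = i] and [l = j]. *)
Lemma wt_sep i j k l : i != j ->
  (forall h : subvs_of H, wt i (vsval h) - wt j (vsval h) =
     wt k (vsval h) - wt l (vsval h)) -> i = k /\ j = l.
Proof.
move=> ij /=.
pose d : 'rV[C]_3 := \row_m ((m == i)%:R - (m == j)%:R).
have dH : invmx P *m diag_mx d *m P \in H.
  have S m : \sum_n (n == m)%:R = 1 :> C.
    by rewrite (bigD1 m) //= eqxx big1 ?addr0 // => n /negPf->.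
  apply: P_mem; under eq_bigr => m _ do rewrite mxE.
  by rewrite sumrB !S subrr.
move=> /(_ (vsproj H (invmx P *m diag_mx d *m P))).
rewrite vsprojK // !conj_diag !mxE !eqxx [j == i]eq_sym (negPf ij) /= => W.
(* Negative terms change sides so that both are natural numbers, comparable in characteristic
   zero. *)
have : (2 + (k == j) + (l == i))%:R = ((k == i) + (l == j))%:R :> C.
  rewrite !natrD.
  have -> : 2%:R + (k == j)%:R + (l == i)%:R =
      (1 - 0 - (0 - 1)) + (k == j)%:R + (l == i)%:R :> C by ring.
  by rewrite W; ring.
move/eqP; rewrite eqr_nat.
by case: (eqVneq k i) (eqVneq k j) (eqVneq l i) (eqVneq l j) =>
  [->|_] [_|_] [_|_] [->|_].
Qed.

(** In the basis [P], a nonzero entry of [x] at [(i, j)] forces [a] to have weight [(i, j)]. By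
    [wt_sep] only one entry can be nonzero. *)
Lemma root_vector_E (a : dual_of H) x : a != 0 -> root_vector a x ->
  exists i j, [/\ i != j, has_wt a i j & exists2 c, c != 0 & x = c *: E i j].
Proof.
move=> a0 [_ x0 ax]; set y := P *m x *m invmx P.
have wy i j (h : subvs_of H) : (wt i (vsval h) - wt j (vsval h)) * y i j = a h * y i j.
  rewrite -conj_lie ?subvsP // ax -scalemxAr -scalemxAl [LHS]mxE.
  reflexivity.
have yW i j : y i j != 0 -> has_wt a i j.
  by move=> yij h; apply: (mulIf yij); rewrite wy.
have [i [j yij]] : exists i j, y i j != 0.
  apply: contrapT => ny; case/eqP: x0; apply: conj_inj.
  rewrite mulmx0 mul0mx; apply/matrixP => i j; rewrite [RHS]mxE.
  by apply/eqP; apply: contrapT => yij; apply: ny; exists i, j; apply/negP.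
have aij := yW _ _ yij.
have ij : i != j.
  apply: contraNneq a0 => ij; apply/eqP/lfunP => h.
  by rewrite aij ij subrr zero_lfunE.
exists i, j; split=> //; exists (y i j) => //.
apply: conj_inj; rewrite -scalemxAr -scalemxAl conj_E -/y.
apply/matrixP => k l; rewrite [RHS]mxE [delta_mx _ _ _ _]mxE.
have [ykl|ykl] := eqVneq (y k l) 0.
  case: eqVneq => [ki|_]; case: eqVneq => [lj|_]; rewrite /= ?mulr0 //.
  by rewrite -ki -lj ykl mul0r.
have [<- <-] := wt_sep _ _ _ _ ij (fun h : subvs_of H => etrans (esym (aij h)) (yW _ _ ykl h)).
by rewrite !eqxx mulr1.
Qed.

Lemma root_vector_line (a : dual_of H) x y : a != 0 ->
  root_vector a x -> root_vector a y -> exists c, y = c *: x.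
Proof.
move=> a0 /(root_vector_E _ _ a0)[i [j [ij aij [c c0 ->]]]].
move=> /(root_vector_E _ _ a0)[k [l [_ akl [d _ ->]]]].
have [<- <-] := wt_sep _ _ _ _ ij
  (fun h : subvs_of H => etrans (esym (aij h)) (akl h)).
by exists (d / c); rewrite scalerA divfK.
Qed.

Lemma E_neq0 i j : E i j != 0.
Proof.
apply/eqP => /(congr1 (fun z => (P *m z *m invmx P) i j)).
by rewrite conj_E mulmx0 mul0mx !mxE !eqxx; move/eqP; rewrite oner_eq0.
Qed.

Lemma E_root_vector (a : dual_of H) i j : i != j -> has_wt a i j ->
  root_vector a (E i j).
Proof.
move=> ij aij; split; first 2 last.
- move=> h; apply: conj_inj; apply/matrixP => k l.
  rewrite conj_lie ?subvsP // -scalemxAr -scalemxAl !conj_E aij !mxE.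
  by case: eqVneq => [->|_]; case: eqVneq => [->|_]; rewrite ?mulr0.
- by rewrite mem_sl3 /E -mulmxA mxtrace_mulC -mulmxA mulmxV // mulmx1 -mem_sl3 delta_sl3.
- exact: E_neq0.
Qed.

Lemma has_wt_neq0 (a : dual_of H) i j : i != j -> has_wt a i j -> a != 0.
Proof.
move=> ij aij; apply/eqP => a0; have [_ ji] : i = i /\ j = i.
  by apply: (wt_sep _ _ _ _ ij) => h; rewrite -aij a0 zero_lfunE subrr.
by rewrite ji eqxx in ij.
Qed.

Lemma has_wt_inj (a b : dual_of H) i j : has_wt a i j -> has_wt b i j -> a = b.
Proof. by move=> aij bij; apply/lfunP => h; rewrite aij bij. Qed.

Lemma has_wtN (a : dual_of H) i j : has_wt a i j -> has_wt (- a) j i.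
Proof. by move=> aij h; rewrite opp_lfunE aij opprB. Qed.

Lemma has_wtD (a b : dual_of H) i j k :
  has_wt a i j -> has_wt b j k -> has_wt (a + b) i k.
Proof. by move=> aij bjk h; rewrite add_lfunE aij bjk addrA subrK. Qed.

Lemma has_wt_root (a : dual_of H) i j : i != j -> has_wt a i j -> is_root a.
Proof.
move=> ij aij; split; first exact: has_wt_neq0 aij.
by exists (E i j); apply: E_root_vector.
Qed.

Lemma is_root_wt (a : dual_of H) : is_root a ->
  exists i j, i != j /\ has_wt a i j.
Proof. by case=> a0 [x /(root_vector_E _ _ a0)[i [j []]]]; exists i, j. Qed.

Lemma ord3_cases i j k l : i != j -> j != k -> i != k ->
  [\/ l = i, l = j | l = k].
Proof.
move=> ij jk ik; have : l \in [:: i; j; k].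
  have /uniq_min_size U : uniq [:: i; j; k] by rewrite /= !inE negb_or ij ik jk.
  have [||_ ->] := U (enum 'I_3); first by move=> u; rewrite mem_enum.
    by rewrite size_enum_ord.
  by rewrite mem_enum.
by rewrite !inE => /or3P[]/eqP->; [constructor 1|constructor 2|constructor 3].
Qed.

(** * Positive roots and root vectors for a pair of simple roots *)

Section Base.
Variables a1 a2 : dual_of H.
Hypothesis a_free : free [:: a1; a2].

Lemma base_free (u v : C) : u *: a1 + v *: a2 = 0 -> u = 0 /\ v = 0.
Proof.
have /(@freeP _ _ 2 [tuple a1; a2]) F := a_free.
move=> uv; have := F (fun t : 'I_2 => [tuple u; v]`_t).
rewrite !big_ord_recl big_ord0 /= addr0 => /(_ uv) Z.
by split; [exact: (Z 0)|exact: (Z 1)].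
Qed.

Lemma base_indep m n : a1 *+ m + a2 *+ n = 0 -> m = 0%N /\ n = 0%N.
Proof.
rewrite -(scaler_nat m a1) -(scaler_nat n a2) => /base_free[/eqP + /eqP].
by rewrite !pnatr_eq0 => /eqP-> /eqP->.
Qed.

(** The coefficients of [a2 - a1] have opposite signs. Equating would give a relation with
    coefficient [- m.+1] on [a1], or [n.+1] on [a2], and neither is zero. *)
Lemma base_sub (m n : nat) :
  ~ (a2 - a1 = a1 *+ m + a2 *+ n \/ a2 - a1 = - (a1 *+ m + a2 *+ n)).
Proof.
rewrite -(scaler_nat m a1) -(scaler_nat n a2); case=> /eqP.
  rewrite -subr_eq0 => /eqP mn; have [] := @base_free (- m.+1%:R) (1 - n%:R).
    rewrite -[RHS]mn -natr1 scaleNr scalerBl scale1r scalerDl scale1r !opprD.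
    by rewrite [a2 - a1]addrC [RHS]addrACA [- a1 - _]addrC.
  by move/eqP; rewrite oppr_eq0 pnatr_eq0.
rewrite -subr_eq0 opprK => /eqP mn.
have [] := @base_free (m%:R - 1) (n.+1%:R).
  rewrite -[RHS]mn -natr1 scalerBl scalerDl !scale1r.
  by rewrite [a2 - a1]addrC [RHS]addrACA [- a1 + _]addrC [a2 + _]addrC.
by move=> _ /eqP; rewrite pnatr_eq0.
Qed.

Variables i j k : 'I_3.
Hypotheses (ij : i != j) (jk : j != k) (ik : i != k).
Hypotheses (a1_ij : has_wt a1 i j) (a2_jk : has_wt a2 j k).

(** A root has one of six weights [(u, v)]: three give [a1], [a2] and [a1 + a2], and the other three
    give their opposites, which are not positive. *)
Lemma positive_root_chain b :
  positive_root a1 a2 b <-> [\/ b = a1, b = a2 | b = a1 + a2].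
Proof.
have a12_ik := has_wtD _ _ _ _ _ a1_ij a2_jk.
split; last first.
  case=> ->; split; try exact: (has_wt_root _ _ _ _ a1_ij);
    try exact: (has_wt_root _ _ _ _ a2_jk);
    try exact: (has_wt_root _ _ _ _ a12_ik).
  - by exists 1%N, 0%N; rewrite addr0.
  - by exists 0%N, 1%N; rewrite add0r.
  - by exists 1%N, 1%N.
case=> /is_root_wt[u [v [uv buv]]] [m [n bE]].
(* If [b] and [- b] are both nonnegative combinations, adding the two gives zero, so all
   coefficients vanish by independence. *)
have neg m' n' : b = - (a1 *+ m' + a2 *+ n') -> m' = 0%N /\ n' = 0%N.
  move=> bN; have /base_indep[/eqP + /eqP] : a1 *+ (m + m') + a2 *+ (n + n') = 0.
    by rewrite !mulrnDr addrACA -bE bN addNr.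
  by rewrite !addn_eq0 => /andP[_ /eqP->] /andP[_ /eqP->].
have := ord3_cases _ _ _ u ij jk ik; have := ord3_cases _ _ _ v ij jk ik.
case=> vE; case=> uE; rewrite {}uE {}vE ?eqxx // in uv buv.
- have [] := neg 1%N 0%N; last by [].
  by rewrite addr0; apply: has_wt_inj buv (has_wtN _ _ _ a1_ij).
- have [] := neg 1%N 1%N; last by [].
  by apply: has_wt_inj buv (has_wtN _ _ _ a12_ik).
- by constructor 1; apply: has_wt_inj buv a1_ij.
- have [] := neg 0%N 1%N; last by [].
  by rewrite add0r; apply: has_wt_inj buv (has_wtN _ _ _ a2_jk).
- by constructor 3; apply: has_wt_inj buv a12_ik.
- by constructor 2; apply: has_wt_inj buv a2_jk.
Qed.

(** The vectors are multiples [c1], [c2], [c] of [E i j], [E j k], [E i k]. The only nonzero product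
    among these units is [E i j *m E j k = E i k], whence [p = c1 * c2 / c] and [q = 0]. *)
Lemma heisenberg_chain x1 x2 x12 :
  root_vector a1 x1 -> root_vector a2 x2 -> root_vector (a1 + a2) x12 ->
  exists2 p, p != 0 & heisenberg_triple _ x1 x2 x12 p 0.
Proof.
have a12_ik := has_wtD _ _ _ _ _ a1_ij a2_jk.
have multE (a : dual_of H) u v x : u != v -> has_wt a u v -> root_vector a x ->
    exists2 c, c != 0 & x = c *: E u v.
  move=> uv auv /root_vector_E[|u' [v' [_ auv' cE]]]; first exact: has_wt_neq0 auv.
  by have [-> ->] := wt_sep _ _ _ _ uv
    (fun h : subvs_of H => etrans (esym (auv h)) (auv' h)).
move=> /(multE _ _ _ _ ij a1_ij)[c1 c10 ->] /(multE _ _ _ _ jk a2_jk)[c2 c20 ->].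
move=> /(multE _ _ _ _ ik a12_ik)[c c0 ->].
exists (c1 * c2 / c); first by rewrite !mulf_neq0 ?invr_neq0.
have [ji kj ki] : [/\ j == i = false, k == j = false & k == i = false].
  by rewrite ![_ == i]eq_sym [k == j]eq_sym (negPf ij) (negPf jk) (negPf ik).
split; rewrite -?scalemxAl -?scalemxAr ?E_mul ?eqxx ?ji ?kj ?ki
  ?(negPf ij) ?(negPf jk) ?(negPf ik) ?scale0r ?scaler0 //.
- apply/(@freeP _ _ 3 [tuple c1 *: E i j; c2 *: E j k; c *: E i k]) => t.
  rewrite !big_ord_recl big_ord0 /= addr0 !scalerA => tE.
  have coef u v : t 0 * c1 * (delta_mx i j : M) u v +
    (t (lift 0 0) * c2 * (delta_mx j k : M) u v +
     t (lift 0 (lift 0 0)) * c * (delta_mx i k : M) u v) = 0.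
    have := congr1 (fun z => (P *m z *m invmx P) u v) tE.
    rewrite mulmx0 mul0mx !mulmxDr !mulmxDl -!scalemxAr -!scalemxAl !conj_E.
    by rewrite !mxE.
  have := (coef i j, coef j k, coef i k); rewrite !mxE !eqxx ?ji ?kj ?ki.
  rewrite ?(negPf ij) ?(negPf jk) ?(negPf ik) /= !mulr0 !mulr1 !addr0 !add0r.
  case=> [[/eqP + /eqP +] /eqP]; rewrite !mulf_eq0 (negPf c10) (negPf c20) (negPf c0) !orbF.
  move=> /eqP t0 /eqP t1 /eqP t2 n.
  have : [\/ n = 0, n = lift 0 0 | n = lift 0 (lift 0 0)] by apply: ord3_cases.
  by case=> ->.
- by rewrite !scalerA divfK // mulr1.
- by rewrite !mulf_neq0 ?invr_neq0.
Qed.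
End Base.

Lemma heisenberg_sym x1 x2 x12 p q :
  heisenberg_triple C x1 x2 x12 p q -> heisenberg_triple C x2 x1 x12 q p.
Proof.
case=> F *; split; rewrite // 1?eq_sym //.
by rewrite -(perm_free (permEl (perm_catCA [:: x1] [:: x2] [:: x12]))).
Qed.

(* In terms of matrix entries, two simple roots are chained: a1 lives at
   (i, j), and a2 at (j, k) or at (k, i).  In every other relative position
   a1 = a2, a1 = - a2, or a2 - a1 is a root. *)
Lemma simple_roots_heisenberg (a1 a2 : dual_of H) : simple_roots a1 a2 ->
  (forall b, positive_root a1 a2 b <-> [\/ b = a1, b = a2 | b = a1 + a2]) /\
  (forall x1 x2 x12, root_vector a1 x1 -> root_vector a2 x2 ->
     root_vector (a1 + a2) x12 ->
     exists p q, heisenberg_triple C x1 x2 x12 p q).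
Proof.
case=> /is_root_wt[i [j [ij aij]]] /is_root_wt[k [l [kl bkl]]] a_basis a_base.
have a_free := basis_free a_basis.
have a_sub : ~ is_root (a2 - a1) by case/a_base => m [n]; apply: base_sub.
have a_sub' : ~ is_root (a1 - a2).
  move=> /is_root_wt[u [v [uv /has_wtN]]]; rewrite opprB => /has_wt_root.
  by rewrite eq_sym => /(_ uv).
have [jk|jk] := eqVneq j k.
  have [il|il] := eqVneq i l.
    have [] := base_indep _ _ a_free 1 1; last by [].
    have <- : - a1 = a2 by apply: has_wt_inj (has_wtN _ _ _ aij) _; rewrite jk il.
    by rewrite subrr.
  subst k; split=> [|x1 x2 x12 h1 h2 h12].
    exact: (positive_root_chain _ _ a_free _ _ _ ij kl il aij bkl).
  have [p _ ?] := heisenberg_chain _ _ _ _ _ ij kl il aij bkl _ _ _ h1 h2 h12.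
  by exists p, 0.
have [il|il] := eqVneq i l.
  subst l; rewrite eq_sym in jk; split=> [b|x1 x2 x12 h1 h2].
    have b_free : free [:: a2; a1] 
      by rewrite -(perm_free (permEl (perm_catC [:: a1] [:: a2]))).
    have pos : positive_root a1 a2 b <-> positive_root a2 a1 b.
      by split=> -[rb [m [n bE]]]; split=> //; exists n, m; rewrite addrC.
    rewrite pos (positive_root_chain _ _ b_free _ _ _ kl ij jk bkl aij) addrC.
    by split; case; [constructor 2|constructor 1|constructor 3
                    |constructor 2|constructor 1|constructor 3].
  rewrite addrC => h12.
  have [p _ ?] := heisenberg_chain _ _ _ _ _ kl ij jk bkl aij _ _ _ h2 h1 h12.
  by exists 0, p; apply: heisenberg_sym.
have [ik|ik] := eqVneq i k.
  subst k; have [jl|jl] := eqVneq j l.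
    subst l; have a12 := has_wt_inj _ _ _ _ aij bkl.
    by move: a_free; rewrite a12 free_cons span_seq1 memv_line.
  case: a_sub; apply: (has_wt_root _ j l jl); rewrite addrC.
  exact: has_wtD (has_wtN _ _ _ aij) bkl.
have [jl|jl] := eqVneq j l.
  subst l; case: a_sub'; apply: (has_wt_root _ i k ik).
  exact: has_wtD aij (has_wtN _ _ _ bkl).
(* Now [i], [j], [k] are distinct and exhaust the indices, so no value is left for [l]. *)
have [] := ord3_cases _ _ _ l ij jk ik; move=> lE.
- by rewrite lE eqxx in il.
- by rewrite lE eqxx in jl.
- by rewrite lE eqxx in kl.
Qed.
End Roots.

(** * The derived algebra of the Borel subalgebra, and the classification *)

(** Elements of [g] split as [H] plus [N]; since [H] is abelian and preserves [N], and [N] is closed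
    under brackets, all brackets fall in [N]. Conversely a positive root [b] is nonzero at some [h],
    so [X b] is a multiple of the bracket of [h] with [X b]. *)
Lemma derived_borel (C : numClosedFieldType) (H g g' : {vspace 'M[C]_3})
    (a1 a2 : dual_of H) (X : dual_of H -> 'M[C]_3) p q : cartan H ->
  (forall b, positive_root a1 a2 b <-> [\/ b = a1, b = a2 | b = a1 + a2]) ->
  (forall b, positive_root a1 a2 b -> root_vector b (X b)) ->
  heisenberg_triple C (X a1) (X a2) (X (a1 + a2)) p q ->
  borel a1 a2 g -> derived_algebra g g' ->
  g' = <<[:: X a1; X a2; X (a1 + a2)%R]>>%VS.
Proof.
move=> cartanH pos hX X_heis hg hg'; have [_ Hab _ _] := cartanH.
have [P Pu Pd] := cartan_codiagonalizable _ _ cartanH.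
have hline b x : positive_root a1 a2 b -> root_vector b x ->
    exists c, x = c *: X b.
  move=> posb bx; have [[b0 _] _] := posb.
  exact: (root_vector_line _ _ _ Pu Pd (cartan_mem _ _ _ cartanH Pu Pd) _ _ _
    b0 (hX _ posb)).
set N := <<_>>%VS.
have pos_in b : positive_root a1 a2 b -> X b \in N.
  by move=> /pos[]->; rewrite memv_span // !inE eqxx ?orbT.
have gP y : y \in g -> exists2 h, h \in H & exists2 n, n \in N & y = h + n.
  have /subvP gHN : (g <= H + N)%VS.
    (* By the universal property of the span, it suffices to place the generators of [g] in [H + N];
       root spaces being lines, every positive root vector is a multiple of the chosen [X b]. *)
    apply/hg => x [xH|[b posb /(hline _ _ posb)[c ->]]].
      exact: (subvP (addvSl _ _)).
    by apply: (subvP (addvSr _ _)); rewrite memvZ ?pos_in.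
  by move=> /gHN/memv_addP[h hH [n nN ->]]; exists h => //; exists n.
have Hroot b h : h \in H -> positive_root a1 a2 b ->
    exists c, lie h (X b) = c *: X b.
  move=> hH /hX[_ _ /(_ (vsproj H h))]; rewrite vsprojK // => ->.
  by eexists.
have HN h n : h \in H -> n \in N -> lie h n \in N.
  move=> hH /heis_memP[u [v [w ->]]].
  rewrite !lieDr !lieZr.
  have L b : positive_root a1 a2 b -> lie h (X b) \in N.
    by move=> posb; have [c ->] := Hroot _ _ hH posb; rewrite memvZ ?pos_in.
  by rewrite !memvD ?memvZ ?L //; apply/pos; [constructor 1|constructor 2|constructor 3].
apply/eqP; rewrite eqEsubv; apply/andP; split.
  apply/hg' => _ [x [y [/gP[h hH [n nN ->]] /gP[h' hH' [n' nN' ->]] ->]]].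
  rewrite !lieDl !lieDr (Hab _ _ hH hH') add0r [lie n h']lieC.
  have nn' : lie n n' \in N.
    have /heis_memP[u [v [w ->]]] := nN; have /heis_memP[u' [v' [w' ->]]] := nN'.
    by rewrite (heis_lie _ _ _ _ _ _ X_heis); apply/heis_memP; do 3!eexists.
  by apply: memvD; [exact: HN|apply: memvD => //; rewrite memvN; exact: HN].
apply/span_subvP => x; rewrite !inE => xX.
have [b posb {x xX}->] : exists2 b, positive_root a1 a2 b & x = X b.
  by case/or3P: xX => /eqP->; eexists; try reflexivity; apply/pos;
    [constructor 1|constructor 2|constructor 3].
have [[b0 _] _] := posb; have [_ _ bX] := hX _ posb.
have [h bh] : exists h : subvs_of H, b h != 0.
  apply: contrapT => nb; case/eqP: b0; apply/lfunP => h; rewrite zero_lfunE.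
  by apply/eqP; apply: contrapT => /negP bh; apply: nb; exists h.
rewrite -[X b]scale1r -(mulVf bh) -scalerA memvZ // -bX.
(* Taking the span itself as the test space in its universal property shows that it contains its
   generators; the same is done for [g]. *)
apply: (proj1 (hg' g')); first exact: subvv.
exists (vsval h), (X b); split=> //; apply: (proj1 (hg g)); rewrite ?subvv //.
  by left; apply: subvsP.
by right; exists b => //; apply: hX.
Qed.

Theorem mainTheorem3 (R : realType)
    (H : {vspace 'M[CC R]_3}) (hH : cartan H)
    (a1 a2 : dual_of H) (hbase : simple_roots a1 a2)
    (X : dual_of H -> 'M[CC R]_3)
    (hX : forall b, positive_root a1 a2 b -> root_vector b (X b))
    (g g' : {vspace 'M[CC R]_3})
    (hg : borel a1 a2 g) (hg' : derived_algebra g g') :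
  [/\ forall b, positive_root a1 a2 b <-> [\/ b = a1, b = a2 | b = a1 + a2],
      g' = <<[:: X a1; X a2; X (a1 + a2)%R]>>%VS,
      class_representatives g' 1 (rep1 (X a1) (X a2) (X (a1 + a2)))
    & class_representatives g' 2 (rep2 (X a1) (X a2) (X (a1 + a2)))].
Proof.
have [P Pu Pd] := cartan_codiagonalizable _ _ hH.
have [pos heis] := simple_roots_heisenberg _ _ _ Pu Pd (cartan_mem _ _ _ hH Pu Pd) _ _ hbase.
have [p [q X_heis]] : exists p q,
    heisenberg_triple _ (X a1) (X a2) (X (a1 + a2)) p q.
  by apply: heis; apply/hX/pos; [constructor 1|constructor 2|constructor 3].
have g'E := derived_borel _ _ _ _ _ _ _ _ _ hH pos hX X_heis hg hg'.
split=> //; rewrite g'E; first exact: heis_representatives1 X_heis.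
exact: heis_representatives2 X_heis.
Qed.
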